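(* Let $G$ be a locally compact, Hausdorff and étale groupoid with non-compact unit space, and let $\widetilde G$ be its Alexandrov groupoid. Then the dynamic asymptotic dimension of $G$ equals the dynamic asymptotic dimension of $\widetilde G$.
   Context: For a topological groupoid $G$ with unit space $G^{(0)}$, $r(g)=gg^{-1}$, $s(g)=g^{-1}g$; $G$ is étale if $r$ is a local homeomorphism. Alexandrov groupoid. Let $G$ be a locally compact Hausdorff groupoid whose unit space is open in $G$ and non-compact (étale groupoids have open unit space). Let $G^{(0)}_+=G^{(0)}\cup\{\infty\}$ be the one-point compactification of $G^{(0)}$. Put $\widetilde G=G\cup\{\infty\}$, $\widetilde G^{(2)}=G^{(2)}\cup\{(\infty,\infty)\}$, $\widetilde G^{(0)}=G^{(0)}_+$; multiplication and inversion extend those of $G$ with $\infty\infty=\infty=\infty^{-1}$, and $r,s$ extend so that $r^{-1}(\infty)=s^{-1}(\infty)=\{\infty\}$. The topology of $\widetilde G$ has as basis the collection consisting of $\widetilde G$, all open subsets of $G^{(0)}_+$ and all open subsets of $G$. When $G$ is étale, $\widetilde G$ is a locally compact Hausdorff étale groupoid. Dynamic asymptotic dimension of a locally compact Hausdorff étale groupoid $G$: the smallest $d\in\mathbf N=\{0,1,2,\dots\}$ such that for every open precompact (i.e. having compact closure) $V\subset G$ there are open sets $U_0,\dots,U_d\subset G^{(0)}$ covering $s(V)\cup r(V)$ such that for each $i$ the set $\{\gamma\in V: s(\gamma),r(\gamma)\in U_i\}$ is contained in a precompact subgroupoid of $G$; it is $\infty$ if no such $d$ exists. *)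

(* Defs.v *)
From HB Require Import structures.
From mathcomp Require Import all_boot all_order all_algebra.
From mathcomp Require Import all_classical all_reals.
From mathcomp Require Import topology.

Set Implicit Arguments.
Unset Strict Implicit.
Unset Printing Implicit Defensive.

Local Open Scope classical_set_scope.

(* The arrow-only axioms (Hahn, Renault): [composable] is the set G^(2), and
   [gmul] is total but its values outside G^(2) carry no meaning. *)
HB.mixin Record isGroupoid (G : Type) := {
  composable : set (G * G);
  gmul : G -> G -> G;
  ginv : G -> G;
  ginvK : involutive ginv;
  composable_gmull : forall g h k, composable (g, h) -> composable (h, k) ->
    composable (gmul g h, k);
  composable_gmulr : forall g h k, composable (g, h) -> composable (h, k) ->
    composable (g, gmul h k);
  gmulA : forall g h k, composable (g, h) -> composable (h, k) ->
    gmul g (gmul h k) = gmul (gmul g h) k;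
  composableVg : forall g, composable (ginv g, g);
  gmulKg : forall g h, composable (g, h) -> gmul (ginv g) (gmul g h) = h;
  gmulgK : forall g h, composable (g, h) -> gmul (gmul g h) (ginv h) = g }.

#[short(type="groupoidType")]
HB.structure Definition Groupoid := {G of isGroupoid G}.

(* A groupoid with a topology on its arrows, not yet assumed compatible. *)
#[short(type="preTopologicalGroupoidType")]
HB.structure Definition PreTopologicalGroupoid :=
  {G of isGroupoid G & Topological G}.

HB.mixin Record PreTopologicalGroupoid_isTopological G
    & PreTopologicalGroupoid G := {
  gmul_continuous :
    {within (composable : set (G * G)),
      continuous (fun p : G * G => gmul p.1 p.2)};
  ginv_continuous : continuous (ginv : G -> G) }.

#[short(type="topologicalGroupoidType")]
HB.structure Definition TopologicalGroupoid :=
  {G of PreTopologicalGroupoid G & PreTopologicalGroupoid_isTopological G}.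

Definition gunits (G : groupoidType) : set G :=
  range (fun g : G => gmul g (ginv g)).
Arguments gunits : clear implicits.

Lemma gmulgV_units (G : groupoidType) (g : G) :
  gmul g (ginv g) \in gunits G.
Proof. by apply: mem_set; exists g. Qed.

Lemma gmulVg_units (G : groupoidType) (g : G) :
  gmul (ginv g) g \in gunits G.
Proof. by apply: mem_set; exists (ginv g) => //; rewrite ginvK. Qed.

(* [gunits G], used as a type, is the unit space with the subspace topology. *)
Definition gr (G : groupoidType) (g : G) : gunits G :=
  exist (fun x => x \in gunits G) _ (gmulgV_units g).
Definition gs (G : groupoidType) (g : G) : gunits G :=
  exist (fun x => x \in gunits G) _ (gmulVg_units g).

Lemma composableP (G : groupoidType) (g h : G) :
  composable (g, h) <-> gs g = gr h.
Proof.
have mulgVg (k : G) : gmul (gmul k (ginv k)) k = k.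
  have := composableVg (ginv k); rewrite ginvK => /gmulgK.
  by rewrite ginvK.
have composablegV (k : G) : composable (k, ginv k).
  by have := composableVg (ginv k); rewrite ginvK.
split=> [gh|/(congr1 \val)/= e].
  have gh_hV := composable_gmull _ _ _ gh (composablegV h).
  have gV_gh := composable_gmulr _ _ _ (composableVg g) gh.
  apply: val_inj => /=; have := gmulA _ _ _ gV_gh gh_hV.
  by rewrite (gmulKg _ _ gh) (gmulgK _ _ gh).
have g_gVg := composable_gmulr _ _ _ (composablegV g) (composableVg g).
rewrite e in g_gVg.
have hhV_h := composable_gmull _ _ _ (composablegV h) (composableVg h).
by have := composable_gmulr _ _ _ g_gVg hhV_h; rewrite mulgVg.
Qed.

Definition local_homeomorphism (X Y : topologicalType) (f : X -> Y) : Prop :=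
  forall x : X, exists U : set X,
    [/\ open U, U x, open (f @` U) &
      exists f' : Y -> X,
        [/\ {in U, cancel f f'}, {within U, continuous f} &
            {within f @` U, continuous f'}]].

Definition etale (G : preTopologicalGroupoidType) : Prop :=
  local_homeomorphism (@gr G).

Definition subgroupoid (G : groupoidType) (H : set G) : Prop :=
  (forall g h, H g -> H h -> composable (g, h) -> H (gmul g h)) /\
  (forall g, H g -> H (ginv g)).

Definition dad_coverable (G : preTopologicalGroupoidType) (d : nat) : Prop :=
  forall V : set G, open V -> precompact V ->
    exists U : 'I_d.+1 -> set (gunits G),
      [/\ forall i, open (U i),
          (@gs G) @` V `|` (@gr G) @` V `<=` \bigcup_i U i &
          forall i, exists H : set G,
            [/\ subgroupoid H, precompact H &
                [set g | [/\ V g, U i (gs g) & U i (gr g)]] `<=` H]].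

Definition dynamic_asymptotic_dimension (G : preTopologicalGroupoidType) :
    \bar nat :=
  if pselect (exists d, `[< dad_coverable G d >]) is left ex_d
  then (ex_minn ex_d)%:E%E else +oo%E.

(* [None] is the added point; the argument is a topological groupoid because
   the topology below depends on its unit space. *)
Definition alexandrov (G : preTopologicalGroupoidType) : Type := option G.

Section alexandrov_groupoid.
Variable G : preTopologicalGroupoidType.
Local Notation aG := (alexandrov G).

HB.instance Definition _ := Choice.on aG.

Definition alexandrov_composable : set (aG * aG) :=
  [set p | match p with
           | (Some g, Some h) => composable (g, h)
           | (None, None) => True
           | _ => False
           end].

Definition alexandrov_mul (x y : aG) : aG :=
  if (x, y) is (Some g, Some h) then Some (gmul g h) else None.

Definition alexandrov_inv (x : aG) : aG := omap ginv x.

Let invK : involutive alexandrov_inv.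
Proof. by case=> [g|] //=; rewrite ginvK. Qed.

Let composable_mull x y z :
  alexandrov_composable (x, y) -> alexandrov_composable (y, z) ->
  alexandrov_composable (alexandrov_mul x y, z).
Proof. by case: x y z => [g|] [h|] [k|] //=; exact: composable_gmull. Qed.

Let composable_mulr x y z :
  alexandrov_composable (x, y) -> alexandrov_composable (y, z) ->
  alexandrov_composable (x, alexandrov_mul y z).
Proof. by case: x y z => [g|] [h|] [k|] //=; exact: composable_gmulr. Qed.

Let mulA x y z :
  alexandrov_composable (x, y) -> alexandrov_composable (y, z) ->
  alexandrov_mul x (alexandrov_mul y z) = alexandrov_mul (alexandrov_mul x y) z.
Proof.
by case: x y z => [g|] [h|] [k|] //= gh hk; congr Some; exact: gmulA.
Qed.

Let composableVx x : alexandrov_composable (alexandrov_inv x, x).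
Proof. by case: x => [g|] //=; exact: composableVg. Qed.

Let mulKx x y : alexandrov_composable (x, y) ->
  alexandrov_mul (alexandrov_inv x) (alexandrov_mul x y) = y.
Proof. by case: x y => [g|] [h|] //= gh; congr Some; exact: gmulKg. Qed.

Let mulxK x y : alexandrov_composable (x, y) ->
  alexandrov_mul (alexandrov_mul x y) (alexandrov_inv y) = x.
Proof. by case: x y => [g|] [h|] //= gh; congr Some; exact: gmulgK. Qed.

HB.instance Definition _ := isGroupoid.Build aG invK composable_mull
  composable_mulr mulA composableVx mulKx mulxK.

Definition alexandrov_base : set (set aG) :=
  [set A | [\/ A = setT,
    exists2 W : set (one_point_compactification (gunits G)),
      open W & A = omap (fun u : gunits G => \val u) @` W |
    exists2 U : set G, open U & A = Some @` U]].

(* The topology generated by [alexandrov_base]; when the unit space of [G] is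
   open, [alexandrov_base] is a basis of it: see [alexandrov_basis]. *)
HB.instance Definition _ :=
  isSubBaseTopological.Build aG alexandrov_base id.

Lemma alexandrov_base_setI : open (gunits G) -> setI_closed alexandrov_base.
Proof.
move=> oG0.
have mixed (W : set (one_point_compactification (gunits G))) (U : set G) :
    open W -> open U -> alexandrov_base
      ((omap (fun u : gunits G => \val u) @` W : set aG) `&` Some @` U).
  move=> oW oU; apply: Or33.
  have := open_comp (fun u _ =>
    @one_point_compactification_some_continuous (gunits G) u) oW.
  case=> O oO OE; exists ((O `&` gunits G) `&` U).
    by apply: openI => //; exact: openI.
  have OW (u : gunits G) : O (\val u) <-> W (Some u).
    by rewrite -[W _]/((Some @^-1` W) u) -OE.
  apply/seteqP; split=> [x [[w Ww <-] [y Uy]]|x [y [[Oy G0y] Uy] <-]].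
    case: w Ww => [u|//] Wu [yu]; exists y; last by rewrite yu.
    by split=> //; rewrite yu; split; [exact/OW | exact/set_mem/valP].
  split; last by exists y.
  by exists (Some (exist _ y (mem_set G0y))) => //; apply/OW.
move=> A B [->|[W oW ->]|[U oU ->]]; first by rewrite setTI.
- case=> [->|[W' oW' ->]|[U oU ->]].
  + by rewrite setIT; apply: Or32; exists W.
  + apply: Or32; exists (W `&` W'); first exact: openI.
    apply/seteqP; split=> [x [[w Ww <-] [w' Ww' /esym e]]|x [w [Ww Ww'] <-]].
      have {e}ww' : w = w'.
        by case: w w' e {Ww Ww'} => [u|] [v|]//= [/val_inj ->].
      by exists w => //; rewrite ww' in Ww *.
    by split; exists w.
  + exact: mixed.
- case=> [->|[W oW ->]|[U' oU' ->]].
  + by rewrite setIT; apply: Or33; exists U.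
  + by rewrite setIC; exact: mixed.
  + apply: Or33; exists (U `&` U'); first exact: openI.
    apply/seteqP; split=> [x [[w Uw <-] [w' Uw' [e]]]|x [w [Uw Uw'] <-]].
      by exists w => //; split=> //; rewrite -e.
    by split; exists w.
Qed.

Lemma alexandrov_basis : open (gunits G) -> basis alexandrov_base.
Proof.
move=> oG0.
have finI A : finI_from alexandrov_base id A -> alexandrov_base A.
  case=> E EB <-; rewrite bigcap_seq big_seq; apply: big_ind.
  - exact: Or31.
  - exact: alexandrov_base_setI.
  - by move=> B /EB /set_mem.
split=> [A bA|x A].
  exists [set A]; last by rewrite bigcup_set1.
  by move=> _ ->; exact: finI_from1.
rewrite nbhsE => -[O [[D DB <-] [B DBx Bx]] OA].
exists B; first by split=> //; exact/finI/DB.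
by move=> y By; apply: OA; exists B.
Qed.

End alexandrov_groupoid.

(* Main.v *)
(* The unit space of the Alexandrov groupoid is compact, so adjoining it to a
   precompact subgroupoid of [G] yields a precompact subgroupoid. Given a
   precompact [V] in the Alexandrov groupoid, its non-unit arrows lie in a
   compact set [C] of [G]. A cover for a precompact neighbourhood of [C] in [G]
   becomes a cover of the compactified unit space once the complement of the
   union of [s(C)] and [r(C)] is added to every [U_i]; this adds no non-unit
   arrow to the restrictions. Conversely, restrict a cover to [G]; a precompact
   subgroupoid of the Alexandrov groupoid may contain too many units to be
   precompact in [G], so cut it down to the arrows whose source and range are
   sources or ranges of arrows in the closure of [V]. *)

Require Import Defs.
From mathcomp Require Import all_boot all_order all_algebra.
From mathcomp Require Import all_classical all_reals topology.

Set Implicit Arguments.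
Unset Strict Implicit.
Unset Printing Implicit Defensive.

Local Open Scope classical_set_scope.

(** * General topology: fixed points, subspaces, compact neighbourhoods, one-point
    compactification *)

Lemma closed_fixpoints (T : topologicalType) (f : T -> T) :
  hausdorff_space T -> continuous f -> closed [set x | f x = x].
Proof.
move=> hT cf x clx; apply: hT => A B Afx Bx.
have [y [fy [Ay By]]] := clx _ (filterI (cf x A Afx : nbhs x (f @^-1` A)) Bx).
by exists y; split=> //; rewrite -fy.
Qed.

Lemma continuous_into_set_type (S T : topologicalType) (A : set T)
    (f : S -> A) :
  continuous (\val \o f) -> continuous f.
Proof.
move=> /continuousP cf; apply/continuousP => _ [O oO <-].
exact: (cf O oO).
Qed.

Lemma continuous_set_val (T : topologicalType) (A : set T) :
  continuous (\val : A -> T).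
Proof. exact: initial_continuous. Qed.

Lemma hausdorff_set_type (T : topologicalType) (A : set T) :
  hausdorff_space T -> hausdorff_space A.
Proof.
move=> hT u v uv; apply: val_inj; apply: hT => B C Bu Cv.
have [w [Bw Cw]] := uv _ _ (continuous_set_val Bu) (continuous_set_val Cv).
by exists (\val w).
Qed.

Lemma open_set_val (T : topologicalType) (A : set T) (U : set A) :
  open A -> open U -> open (\val @` U : set T).
Proof.
move=> oA [O oO <-]; rewrite (_ : _ @` _ = O `&` A); first exact: openI.
apply/seteqP; split=> [_ [a Oa <-]|x [Ox Ax]].
  by split; last exact/set_mem/valP.
by exists (exist _ x (mem_set Ax)).
Qed.

(** Compactness is used in its near-covering form. Along the filter [F] of ever larger closed
    compact sets, every point has a neighbourhood that is eventually absorbed by the interior, so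
    the whole of [K] is absorbed at some stage. *)
Lemma locally_compact_interior (T : topologicalType) (K : set T) :
  locally_compact [set: T] -> compact K ->
  exists C : set T, [/\ compact C, closed C & K `<=` C°].
Proof.
move=> lT /compact_near_coveringP cK.
pose F : set_system (set T) :=
  filter_from (compact `&` closed) (fun C => [set W | C `<=` W]).
have FF : Filter F.
  apply: filter_from_filter.
    by exists set0; split; [exact: compact0 | exact: closed0].
  move=> A B [cA clA] [cB clB]; exists (A `|` B).
    by split; [exact: compactU | exact: closedU].
  by move=> W /=; rewrite subUset.
have /cK [] : forall x, K x -> \forall x' \near x & W \near F, W° x'.
  move=> x _; have [C] := lT x I; rewrite withinET => Cx [cC clC].
  exists (C°, [set W | C `<=` W]); last first.
    by move=> [x' W] [/= Cx' CW]; apply: interiorS Cx'.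
  by split; [exact: nbhs_interior | exists C].
by move=> C [cC clC] CP; exists C; split=> //; exact: CP.
Qed.

Lemma one_point_compactification_openC (T : topologicalType) (L : set T) :
  compact L -> closed L ->
  open (~` (Some @` L) : set (one_point_compactification T)).
Proof.
move=> cL clL; rewrite openE => -[x|] Lx; last first.
  by exists L => // _ [[y Ly <-]|->] [z Lz] // [zy]; apply: Ly; rewrite -zy.
have : nbhs x (~` L).
  apply: open_nbhs_nbhs; split; first exact: closed_openC.
  by move=> ?; apply: Lx; exists x.
by apply: filterS => y Ly [z Lz [zy]]; apply: Ly; rewrite -zy.
Qed.

(** * Algebra of units, sources and ranges *)

Section groupoid_units.
Variable G : groupoidType.
Implicit Types g h u : G.

Lemma composablegV g : composable (g, ginv g).
Proof. by have := composableVg (ginv g); rewrite ginvK. Qed.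

Lemma gmulgVg g : gmul (gmul g (ginv g)) g = g.
Proof. by have := gmulgK _ _ (composablegV g); rewrite ginvK. Qed.

Lemma gmulgVgr g : gmul g (gmul (ginv g) g) = g.
Proof.
by rewrite gmulA ?gmulgVg //; [exact: composablegV | exact: composableVg].
Qed.

Lemma gs_ginv g : gs (ginv g) = gr g.
Proof. by apply: val_inj; rewrite /= ginvK. Qed.

Lemma gr_ginv g : gr (ginv g) = gs g.
Proof. by apply: val_inj; rewrite /= ginvK. Qed.

Lemma gs_gmul g h : composable (g, h) -> gs (gmul g h) = gs h.
Proof.
move=> gh; rewrite -(gr_ginv h); apply/composableP.
exact: composable_gmull gh (composablegV h).
Qed.

Lemma gr_gmul g h : composable (g, h) -> gr (gmul g h) = gr g.
Proof.
move=> gh; rewrite -(gs_ginv g); apply/esym/composableP.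
exact: composable_gmulr (composableVg g) gh.
Qed.

Lemma gunits_idem u : gunits G u -> composable (u, u) /\ gmul u u = u.
Proof.
case=> g _ <-.
have eg := composable_gmull _ _ _ (composablegV g) (composableVg g).
split; first exact: composable_gmulr eg (composablegV g).
by rewrite gmulA ?gmulgVg //; exact: composablegV.
Qed.

Lemma gunits_gr u : gunits G u -> gmul u (ginv u) = u.
Proof.
move=> /gunits_idem[uu uuE].
by have := gmulgK _ _ uu; rewrite uuE.
Qed.

Lemma gunits_gs u : gunits G u -> gmul (ginv u) u = u.
Proof.
move=> /gunits_idem[uu uuE].
by have := gmulKg _ _ uu; rewrite uuE.
Qed.

Lemma gunits_ginv u : gunits G u -> ginv u = u.
Proof.
move=> u0; have := gmulKg _ _ (composablegV u).
by rewrite gunits_gr// gunits_gs.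
Qed.

Lemma gunitsE : gunits G = [set g | gmul g (ginv g) = g].
Proof. by apply/seteqP; split=> g; [exact: gunits_gr | exists g]. Qed.

Lemma gmul_unitl u g : gunits G u -> composable (u, g) -> gmul u g = g.
Proof.
move=> u0 /composableP/(congr1 \val)/=; rewrite gunits_gs// => ->.
exact: gmulgVg.
Qed.

Lemma gmul_unitr g u : gunits G u -> composable (g, u) -> gmul g u = g.
Proof.
move=> u0 /composableP/(congr1 \val)/=; rewrite gunits_gr// => <-.
exact: gmulgVgr.
Qed.

(** A product with a unit is the other factor, so only products inside [H] need the hypothesis. *)
Lemma subgroupoidU_units (H : set G) :
  subgroupoid H -> subgroupoid (H `|` gunits G).
Proof.
move=> [HM HV]; split=> [g h|g].
  move=> [Hg|u0] Hh gh; last by rewrite gmul_unitl.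
  case: Hh => [Hh|u0]; first by left; exact: HM.
  by rewrite gmul_unitr//; left.
by case=> [Hg|u0]; [left; exact: HV | right; rewrite gunits_ginv].
Qed.

(** A product takes its source and its range from its factors, and inversion swaps the two. *)
Lemma subgroupoid_reduction (H : set G) (L : set (gunits G)) :
  subgroupoid H -> subgroupoid [set g | [/\ H g, L (gs g) & L (gr g)]].
Proof.
move=> [HM HV]; split=> [g h [Hg _ rg] [Hh sh _] gh|g [Hg sg rg]].
  by split; [exact: HM | rewrite gs_gmul | rewrite gr_gmul].
by split; [exact: HV | rewrite gs_ginv | rewrite gr_ginv].
Qed.

End groupoid_units.

(** * Continuity of range and source; the unit space is closed, and open in the étale case *)

Section topological_groupoid.
Variable G : topologicalGroupoidType.

(** Multiplication is continuous only relative to [composable], but the pairs [(h, ginv h)] never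
    leave that set. *)
Lemma continuous_gmulgV : continuous (fun g : G => gmul g (ginv g)).
Proof.
move=> g; have /subspace_continuousP /(_ (g, ginv g) (composablegV g)) :=
  @gmul_continuous G.
apply: cvg_trans => /= A; rewrite /within /= => -[[B C] /= [Bg Cg]] BCA.
have Cg' : nbhs g (ginv @^-1` C) by exact: ginv_continuous.
apply: filterS (filterI Bg Cg') => h [Bh Ch].
by apply: (BCA (h, ginv h)) => //; exact: composablegV.
Qed.

Lemma gr_continuous : continuous (@gr G).
Proof. exact/continuous_into_set_type/continuous_gmulgV. Qed.

Lemma gs_continuous : continuous (@gs G).
Proof.
rewrite (_ : @gs G = @gr G \o ginv); last first.
  by apply/funext => g /=; rewrite gr_ginv.
move=> g; apply: continuous_comp; first exact: ginv_continuous.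
exact: gr_continuous.
Qed.

Lemma closed_gunits : hausdorff_space G -> closed (gunits G).
Proof.
by move=> hG; rewrite gunitsE; apply: closed_fixpoints continuous_gmulgV.
Qed.

(* If [gr] is injective on an open [U], then a [g] in [U] with [r(g)] in [U] is
   a unit, because [r(r(g)) = r(g)]. *)
Lemma etale_open_gunits : etale G -> open (gunits G).
Proof.
move=> eG; rewrite openE => u u0.
have [U [oU Uu _ [f' [f'K _ _]]]] := eG u.
have rU : nbhs u ((fun g : G => gmul g (ginv g)) @^-1` U).
  by apply: continuous_gmulgV; rewrite /= gunits_gr//; exact: open_nbhs_nbhs.
apply: filterS (filterI (open_nbhs_nbhs (conj oU Uu)) rU) => g [Ug /= Ur].
have r0 : gunits G (gmul g (ginv g)) by exists g.
suff -> : g = gmul g (ginv g) by [].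
by apply: (can_in_inj f'K); rewrite ?inE//;
  apply: val_inj; rewrite /= (gunits_gr r0).
Qed.

End topological_groupoid.

(** * Topology of the Alexandrov groupoid: embeddings and compact sets *)

Section alexandrov_topology.
Variable G : preTopologicalGroupoidType.
Hypothesis oG0 : open (gunits G).
Local Notation aG := (alexandrov G).
Local Notation opc := (one_point_compactification (gunits G)).
Local Notation unit_incl := (omap (fun u : gunits G => \val u) : opc -> aG).

Lemma alexandrov_unitsE : gunits aG = None |` Some @` gunits G.
Proof.
apply/seteqP; split=> [_ [[g|] _ <-]|x].
- by right; exists (gmul g (ginv g)) => //; exists g.
- by left.
- by case=> [->|[_ [g _ <-] <-]]; [exists None | exists (Some g)].
Qed.

Lemma range_unit_incl : range unit_incl = gunits aG.
Proof.
rewrite alexandrov_unitsE; apply/seteqP; split=> [_ [[u|] _ <-]|x].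
- by right; exists (\val u) => //; exact/set_mem/valP.
- by left.
- case=> [->|[u u0 <-]]; first by exists None.
  by exists (Some (exist _ u (mem_set u0))).
Qed.

Lemma alexandrov_base_open (A : set aG) : @alexandrov_base G A -> open A.
Proof. exact: (alexandrov_basis oG0).1. Qed.

Lemma alexandrov_open_some (U : set G) : open U -> open (Some @` U : set aG).
Proof. by move=> oU; apply: alexandrov_base_open; apply: Or33; exists U. Qed.

Lemma alexandrov_open_units (W : set opc) : open W -> open (unit_incl @` W).
Proof. by move=> oW; apply: alexandrov_base_open; apply: Or32; exists W. Qed.

Lemma continuous_to_alexandrov (T : topologicalType) (f : T -> aG) :
  (forall A, @alexandrov_base G A -> open (f @^-1` A)) -> continuous f.
Proof.
move=> fB x A /(alexandrov_basis oG0).2 [B [bB Bfx] BA].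
apply: filterS (open_nbhs_nbhs (conj (fB B bB) Bfx)) => y; exact: BA.
Qed.

Lemma alexandrov_some_continuous : continuous (Some : G -> aG).
Proof.
apply: continuous_to_alexandrov => A [->|[W oW ->]|[U oU ->]].
- exact: openT.
(* The preimage is at first open only in the unit space; [oG0] makes it open in [G]. *)
- rewrite (_ : _ @^-1` _ = \val @` (Some @^-1` W : set (gunits G))).
    apply: open_set_val => //; apply: open_comp oW => u _.
    exact: one_point_compactification_some_continuous.
  apply/seteqP; split=> [g [[u|//] Wu [<-]]|_ [u Wu <-]]; first by exists u.
  by exists (Some u).
- rewrite (_ : _ @^-1` _ = U)//.
  by apply/seteqP; split=> [g [h Uh [<-]]|g Ug] //; exists g.
Qed.

Lemma unit_incl_continuous : continuous unit_incl.
Proof.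
apply: continuous_to_alexandrov => A [->|[W oW ->]|[U oU ->]].
- exact: openT.
- rewrite (_ : _ @^-1` _ = W)//.
  apply/seteqP; split=> [w [w' Ww' e]|w Ww]; last by exists w.
  suff -> : w = w' by [].
  by case: w w' e {Ww'} => [u|] [v|]//= [/val_inj ->].
- rewrite (_ : _ @^-1` _ = Some @` (\val @^-1` U : set (gunits G))).
    apply: one_point_compactification_open_some.
    by apply: open_comp oU => u _; exact: continuous_set_val.
  apply/seteqP; split=> [[u|] [g Ug //= [gu]]|_ [u Uu <-]]; last first.
    by exists (\val u).
  by exists u => //=; rewrite -gu.
Qed.

Lemma compact_alexandrov_units : compact (gunits aG).
Proof.
rewrite -range_unit_incl; apply: continuous_compact.
  exact/continuous_subspaceT/unit_incl_continuous.
exact: one_point_compactification_compact.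
Qed.

(** If [K] is a closed compact set containing [H], adding all units to [K] keeps it compact and puts
    infinity inside it. The complement then consists of arrows of [G] only, and it is open because
    [K] and the unit space are closed in [G]. *)
Lemma precompact_alexandrovU_units (H : set G) :
  closed (gunits G) -> precompact H ->
  precompact (Some @` H `|` gunits aG : set aG).
Proof.
move=> clG0 [K HK [cK clK]]; exists (Some @` K `|` gunits aG).
  exact/setSU/image_subset.
split.
  apply: compactU compact_alexandrov_units; apply: continuous_compact cK.
  exact/continuous_subspaceT/alexandrov_some_continuous.
rewrite -openC alexandrov_unitsE.
rewrite (_ : ~` _ = Some @` (~` K `&` ~` gunits G)).
  by apply/alexandrov_open_some/openI; exact: closed_openC.
apply/seteqP; split=> [[g|] gN|_ [g [Kg g0] <-]].
- exists g => //; split=> ?; apply: gN; first by left; exists g.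
  by right; right; exists g.
- by case: gN; right; left.
- case=> [[h Kh [hg]]|[//|[h h0 [hg]]]]; first by apply: Kg; rewrite -hg.
  by apply: g0; rewrite -hg.
Qed.

(** The units of the Alexandrov groupoid form an open set containing infinity. Removing them from
    [K] leaves a compact set of arrows of [G], which a left inverse of [Some] carries back to
    [G]. *)
Lemma compact_some_preimage (K : set aG) :
  compact K -> compact [set g | K (Some g) /\ ~ gunits G g].
Proof.
move=> cK; set C := [set g | _].
have cD : compact (K `&` ~` gunits aG).
  apply: compact_closedI => //; apply: open_closedC.
  by rewrite -range_unit_incl; exact/alexandrov_open_units/openT.
have DE : K `&` ~` gunits aG = Some @` C.
  rewrite alexandrov_unitsE; apply/seteqP.
  split=> [[g|] [Kg g0]|_ [g [Kg g0] <-]].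
  - by exists g => //; split=> // gu; apply: g0; right; exists g.
  - by case: g0; left.
  - by split=> // -[//|[h h0 [hg]]]; apply: g0; rewrite -hg.
(* [g0] only serves as the value at infinity of the left inverse [f]; it is available unless [C] is
   empty. *)
have [[g0 _]|C0] := pselect (C !=set0); last first.
  by rewrite (_ : C = set0); [exact: compact0 | apply/nonemptyPn].
rewrite {}DE in cD; pose f (x : aG) := odflt g0 x.
have -> : C = f @` (Some @` C) by rewrite image_comp /= image_id.
apply: continuous_compact cD.
(* [Some] is an open map, so [f] is continuous at every arrow of [G]. *)
apply: continuous_in_subspaceT => _ /set_mem[g _ <-] A /=.
rewrite {1}nbhsE /= => -[O [oO Og] OA].
apply: (@filterS _ _ _ (Some @` O)); first by move=> _ [h Oh <-]; exact: OA.
by apply: open_nbhs_nbhs; split; [exact: alexandrov_open_some | exists g].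
Qed.

End alexandrov_topology.

(** * Transfer of covers between the two groupoids *)

Lemma dad_coverable_to_alexandrov (G : topologicalGroupoidType) (d : nat) :
  locally_compact [set: G] -> hausdorff_space G -> open (gunits G) ->
  dad_coverable G d -> dad_coverable (alexandrov G) d.
Proof.
move=> lG hG oG0 dG V oV [K VK [cK _]].
pose C := [set g : G | K (Some g) /\ ~ gunits G g].
have cC : compact C by exact: compact_some_preimage.
have [K1 [cK1 clK1 CK1]] := locally_compact_interior lG cC.
have [|U [oU Ucov UH]] := dG K1° (open_interior _).
  by exists K1 => //; exact: interior_subset.
pose L := @gs G @` C `|` @gr G @` C.
have cL : compact L.
  apply: compactU; apply: continuous_compact cC; apply: continuous_subspaceT.
    exact: gs_continuous.
  exact: gr_continuous.
have clL : closed L.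
  by apply: compact_closed cL; exact: hausdorff_set_type.
(* Since [L] is compact and closed, the added set is an open neighbourhood of infinity. *)
pose O i : set (alexandrov G) := Some @` (\val @` U i) `|`
  omap (fun u : gunits G => \val u) @` (~` (Some @` L)).
have oO i : open (O i).
  apply: openU; first by apply/alexandrov_open_some/open_set_val.
  apply: alexandrov_open_units => //.
  exact: one_point_compactification_openC.
(* Over [L] the enlarged sets are no larger than the [U i], so they restrict the arrows of [C] in
   the same way. *)
have LU i (u : gunits G) : L u -> O i (Some (\val u)) -> U i u.
  move=> Lu [[_ [v Uv <-] [/val_inj <-]]|[[v|//] Lv [/val_inj vu]]] //.
  by case: Lv; exists u; rewrite ?vu.
exists (fun i => \val @^-1` O i); split.
- by move=> i; exists (O i).
- move=> w _; have [v _ vw] : range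
      (omap (fun u : gunits G => \val u) : option (gunits G) -> alexandrov G)
      (\val w).
    by rewrite range_unit_incl; exact/set_mem/valP.
  (* A unit off [L], infinity included, lies in every [O i], so any index will do. Thus all units
     are covered, not just those met by [V]. *)
  have [[u Lu uv]|Lv] := pselect ((Some @` L) v); last first.
    by exists ord0 => //; right; exists v.
  have [i _ Uu] : (\bigcup_i U i) u.
    apply: Ucov; case: Lu => -[c Cc <-]; [left | right]; exists c => //.
      exact: CK1.
    exact: CK1.
  by exists i => //; left; exists (\val u); [exists u | rewrite -vw -uv].
- move=> i; have [H [sH pH VH]] := UH i.
  exists (Some @` H `|` gunits (alexandrov G)); split.
  + apply: subgroupoidU_units; split=> [_ _ [g Hg <-] [h Hh <-] gh|_ [g Hg <-]].
      by exists (gmul g h) => //; exact: sH.1.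
    by exists (ginv g) => //; exact: sH.2.
  + by apply: precompact_alexandrovU_units => //; exact: closed_gunits.
  + move=> [g|] [/VK Kg /= Os Or]; last first.
      by right; rewrite alexandrov_unitsE; left.
    (* Units are absorbed by the adjoined unit space; only arrows of [C] have to be found in [H]. *)
    have [g0|g0] := pselect (gunits G g).
      by right; rewrite alexandrov_unitsE; right; exists g.
    have Cg : C g by [].
    left; exists g => //; apply: VH; split.
    * exact: CK1.
    * by apply: LU => //; left; exists g.
    * by apply: LU => //; right; exists g.
Qed.

Lemma dad_coverable_of_alexandrov (G : topologicalGroupoidType) (d : nat) :
  hausdorff_space G -> open (gunits G) ->
  dad_coverable (alexandrov G) d -> dad_coverable G d.
Proof.
move=> hG oG0 dG V oV pV.
have clG0 := closed_gunits hG.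
have [K VK [cK _]] := pV.
have [||U [oU Ucov UH]] := dG (Some @` V).
- exact: alexandrov_open_some.
- apply: precompact_subset (precompact_alexandrovU_units oG0 clG0 pV).
  exact: subsetUl.
have j_unit (u : gunits G) :
    (Some (\val u) : alexandrov G) \in gunits (alexandrov G).
  apply: mem_set; rewrite alexandrov_unitsE; right.
  by exists (\val u) => //; exact/set_mem/valP.
pose j (u : gunits G) : gunits (alexandrov G) :=
  exist (fun x => x \in gunits (alexandrov G)) _ (j_unit u).
have cj : continuous j.
  apply: continuous_into_set_type => u.
  apply: (@continuous_comp _ G); first exact: continuous_set_val.
  exact: alexandrov_some_continuous.
have jr g : j (gr g) = gr (Some g : alexandrov G) by exact: val_inj.
have js g : j (gs g) = gs (Some g : alexandrov G) by exact: val_inj.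
(* A precompact [H] may contain every unit, and these need not be precompact in [G]. The compact set
   [L] bounds the units that are kept. *)
pose L := @gs G @` K `|` @gr G @` K.
have cL : compact L.
  apply: compactU; apply: continuous_compact cK; apply: continuous_subspaceT.
    exact: gs_continuous.
  exact: gr_continuous.
exists (fun i => j @^-1` U i); split.
- by move=> i; apply: open_comp (oU i) => u _; exact: cj.
- move=> u Vu; have [i _ Ui] : (\bigcup_i U i) (j u).
    apply: Ucov; case: Vu => -[g Vg <-]; [left | right].
      by exists (Some g) => //; exists g.
    by exists (Some g) => //; exists g.
  by exists i.
- move=> i; have [H [sH [K2 HK2 [cK2 _]] VH]] := UH i.
  exists [set g | [/\ H (Some g), L (gs g) & L (gr g)]]; split.
  + apply: (@subgroupoid_reduction _ (Some @^-1` H)); split=> [g h|g] /=.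
      by move=> Hg Hh gh; exact: (sH.1 (Some g) (Some h)).
    by move=> Hg; exact: (sH.2 (Some g)).
  (* Non-unit arrows are controlled by the compact set [K2], units by [L], since a unit is its own
     range. *)
  + pose C := [set g : G | K2 (Some g) /\ ~ gunits G g] `|` \val @` L.
    apply: (@precompact_subset _ _ C).
      move=> g [/HK2 K2g _ Lr].
      have [g0|g0] := pselect (gunits G g); last by left.
      by right; exists (gr g) => //=; exact: gunits_gr.
    apply: compact_precompact => //; apply: compactU.
      exact: compact_some_preimage.
    apply: continuous_compact cL; exact/continuous_subspaceT/continuous_set_val.
  + move=> g [Vg Us Ur]; split; last 2 first.
    * by left; exists g => //; exact: VK.
    * by right; exists g => //; exact: VK.
    by apply: VH; split; [exists g | rewrite -js | rewrite -jr].
Qed.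

Theorem proposition3p13 (G : topologicalGroupoidType)
    (G_locally_compact : locally_compact [set: G])
    (G_hausdorff : hausdorff_space G)
    (G_etale : etale G)
    (units_noncompact : ~ compact (gunits G)) :
  dynamic_asymptotic_dimension G =
  dynamic_asymptotic_dimension (alexandrov G).
Proof.
have oG0 := etale_open_gunits G_etale.
rewrite /dynamic_asymptotic_dimension.
(* Each dimension is the same function of the predicate [dad_coverable], so equality of the
   predicates settles the finite and infinite cases together. *)
suff -> : dad_coverable G = dad_coverable (alexandrov G) by [].
apply/funext => d; apply/propext; split.
  exact: dad_coverable_to_alexandrov.
exact: dad_coverable_of_alexandrov.
Qed.
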